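(* Let $n\ge 2$ and let $g\in\mathcal L^2([0,1]^n)$, with marginals $g_i(\xi_i):=\int_{[0,1]^{n-1}} g(\xi)\,d\xi_i^c$, $1\le i\le n$. Then $$\int_{[0,1]^n} g^2(\xi)\,d\xi\ \ge\ \sum_{i=1}^n\int_0^1 g_i(\xi_i)^2\,d\xi_i-(n-1)\Big(\int_{[0,1]^n} g(x)\,dx\Big)^2 .$$ The bound is sharp: equality holds if and only if $g$ equals (almost everywhere) the function $$\overline\Phi(\xi):=\Big(\sum_{i=1}^n g_i(\xi_i)\Big)-(n-1)\int_{[0,1]^n} g(x)\,dx .$$
   Context: $\mathcal L^2([0,1]^n)$ denotes the space of (equivalence classes modulo a.e. equality of) real-valued square-integrable Lebesgue-measurable functions on $[0,1]^n$. For $\xi=(\xi_1,\dots,\xi_n)$ and $1\le i\le n$, $\xi_i^c:=(\xi_1,\dots,\xi_{i-1},\xi_{i+1},\dots,\xi_n)$ is the vector $\xi$ with the $i$-th coordinate omitted, and $\int f(\xi)\,d\xi_i^c$ denotes integration over all coordinates in $[0,1]$ except the $i$-th, giving a function of $\xi_i$. *)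

(* Defs.v *)
From HB Require Import structures.
From mathcomp Require Import all_boot all_order all_algebra.
From mathcomp Require Import all_classical all_reals all_analysis.
Import Order.TTheory GRing.Theory Num.Theory.
Import numFieldNormedType.Exports.

Set Implicit Arguments.
Unset Strict Implicit.
Unset Printing Implicit Defensive.

Local Open Scope classical_set_scope.
Local Open Scope ring_scope.

Section cons_measure.
Context (R : realType) d (T : measurableType d) (n : nat).
Variable m1 : {sigma_finite_measure set T -> \bar R}.
Variable m2 : {sigma_finite_measure set (n.-tuple T) -> \bar R}.

Definition tuple_cons (p : T * n.-tuple T) : n.+1.-tuple T :=
  [tuple of p.1 :: p.2].

Lemma measurable_tuple_cons : measurable_fun [set: _] tuple_cons.
Proof. exact: measurable_cons. Qed.

Definition cons_measure : set (n.+1.-tuple T) -> \bar R :=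
  pushforward (m1 \x m2)%E tuple_cons.

Let M : {measure set (n.+1.-tuple T) -> \bar R} :=
  measure_function_pushforward__canonical__measure_function_Measure
    (m1 \x m2)%E measurable_tuple_cons.

HB.instance Definition _ := isMeasure.Build _ _ _ cons_measure
  (measure0 M) (measure_ge0 M) (@measure_semi_sigma_additive _ _ _ M).

Let cons_measure_sigma_finite : sigma_finite [set: n.+1.-tuple T] cons_measure.
Proof.
have /sigma_finiteP[F [TF ndF Foo]] := sigma_finiteT m1.
have /sigma_finiteP[G [TG ndG Goo]] := sigma_finiteT m2.
pose u (t : n.+1.-tuple T) : T * n.-tuple T := (thead t, [tuple of behead t]).
have mu : measurable_fun [set: _] u.
  apply: measurable_fun_pair; first exact: measurable_tnth.
  exact: measurable_behead.
have uK p : u (tuple_cons p) = p.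
  by case: p => x t; congr (_, _); apply/val_inj.
exists (fun k => u @^-1` (F k `*` G k)).
  apply/seteqP; split=> // t _.
  have : [set: T] (u t).1 by [].
  have : [set: n.-tuple T] (u t).2 by [].
  rewrite {1}TF {1}TG => -[k _ Gk] [l _ Fl]; exists (maxn k l) => //; split.
    by move: Fl; exact/subsetPset/ndF/leq_maxr.
  by move: Gk; exact/subsetPset/ndG/leq_maxl.
move=> k; have [mF Fk] := Foo k; have [mG Gk] := Goo k; split.
  by rewrite -[X in measurable X]setTI; apply: mu => //; exact: measurableX.
rewrite /cons_measure /pushforward -comp_preimage.
rewrite (_ : u \o _ = id); last by apply/funext => p; exact: uK.
by rewrite preimage_id product_measure1E// lte_mul_pinfty// ge0_fin_numE.
Qed.

HB.instance Definition _ := @Measure_isSigmaFinite.Build _ _ _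
  cons_measure cons_measure_sigma_finite.

End cons_measure.

(* Lebesgue measure on the Borel sets of R^n, see [borel_lebesgue_box]. *)
Fixpoint borel_lebesgue (R : realType) (n : nat) :
    {sigma_finite_measure set (n.-tuple (measurableTypeR R)) -> \bar R} :=
  match n with
  | 0 => dirac [tuple]
  | n.+1 => cons_measure (@lebesgue_measure R) (borel_lebesgue R n)
  end.

Lemma borel_lebesgue_box (R : realType) (n : nat)
    (A : 'I_n -> set (measurableTypeR R)) :
  (forall i, measurable (A i)) ->
  borel_lebesgue R n [set t | forall i, A i (tnth t i)] =
  (\prod_(i < n) lebesgue_measure (A i))%E.
Proof.
elim: n A => [|n IH] A mA.
  by rewrite big_ord0 /= diracE mem_set // => -[].
rewrite big_ord_recl/= /cons_measure /pushforward.
pose B := [set t : n.-tuple (measurableTypeR R) |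
  forall i, A (lift ord0 i) (tnth t i)].
have mB : measurable B.
  rewrite [X in measurable X](_ : _ =
    \bigcap_(i in [set: 'I_n]) (@tnth _ _ ^~ i) @^-1` A (lift ord0 i)).
    apply: fin_bigcap_measurable => // i _.
    by rewrite -[X in measurable X]setTI; exact: measurable_tnth.
  by apply/seteqP; split=> t /= h i => [_|]; exact: h.
rewrite (_ : _ @^-1` _ = A ord0 `*` B).
  rewrite product_measure1E//; congr (_ * _)%E.
  exact: (IH _ (fun j => mA (lift ord0 j))).
apply/seteqP; split=> -[x t] /=.
  move=> h; split=> [|i]; first by have := h ord0.
  by have := h (lift ord0 i); rewrite tnthS.
move=> [hx ht] i; case: (unliftP ord0 i) => [j|] -> //.
by rewrite tnthS; exact: ht.
Qed.

(* R^n with its Lebesgue-measurable sets, i.e. the Caratheodory-measurable sets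
   of the outer measure induced by [borel_lebesgue], and the complete Lebesgue
   measure on it. *)
Definition lebesgue_space (R : realType) (n : nat) : measurableType _ :=
  caratheodory_type (borel_lebesgue R n)^*%mu.

Definition lebesgue (R : realType) (n : nat) :
    {measure set (lebesgue_space R n) -> \bar R} :=
  @completed_measure_extension _ _ _ (borel_lebesgue R n).

Definition unit_cube (R : realType) (n : nat) : set (lebesgue_space R n) :=
  [set x : n.-tuple R | forall i, tnth x i \in `[0, 1]].
Arguments unit_cube : clear implicits.

(* Representatives of the classes in L^2([0,1]^n): the values of g outside the
   cube are irrelevant. *)
Definition L2_unit_cube (R : realType) (n : nat)
    (g : lebesgue_space R n -> measurableTypeR R) : Prop :=
  measurable_fun (unit_cube R n) g /\
  (\int[lebesgue R n]_(x in unit_cube R n) ((g x) ^+ 2)%:E < +oo)%E.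

(* The point of R^n with i-th coordinate x and other coordinates, in order, y. *)
Definition insert_coord (R : realType) (n : nat) (i : 'I_n) (x : R)
    (y : lebesgue_space R n.-1) : lebesgue_space R n :=
  [tuple (if unlift i j is Some k then tnth (y : n.-1.-tuple R) k else x)
    | j < n].

(* Only almost every x is guaranteed a finite integral; [Rintegral] gives a
   real value on the exceptional null set as well. *)
Definition marginal (R : realType) (n : nat)
    (g : lebesgue_space R n -> measurableTypeR R) (i : 'I_n) (x : R) : R :=
  \int[lebesgue R n.-1]_(y in unit_cube R n.-1) g (insert_coord i x y).

Definition Phi_bar (R : realType) (n : nat)
    (g : lebesgue_space R n -> measurableTypeR R)
    (x : lebesgue_space R n) : R :=
  (\sum_(i < n) marginal g i (tnth (x : n.-tuple R) i)) -
  n.-1%:R * \int[lebesgue R n]_(y in unit_cube R n) g y.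

(* Main.v *)
Require Import Defs.
From HB Require Import structures.
From mathcomp Require Import all_boot all_order all_algebra.
From mathcomp Require Import all_classical all_reals all_analysis.
From mathcomp Require Import measurable_realfun ring lra.
Import Order.TTheory GRing.Theory Num.Theory.
Import numFieldNormedType.Exports.

Set Implicit Arguments.
Unset Strict Implicit.
Unset Printing Implicit Defensive.

Local Open Scope classical_set_scope.
Local Open Scope ring_scope.

(* For g in L^2 of the cube, let f(x) = g_1(x_1) + ... + g_n(x_n) - (n-1) m,
   where m is the mean of g.  By Fubini, integrating g, or f itself, against
   u(x_i) only sees the i-th marginal, and f has the same marginals as g; hence
   <f, g> = <f, f> = sum_i |g_i|^2 - (n-1) m^2, so that
     |g - f|^2 = |g|^2 - (sum_i |g_i|^2 - (n-1) m^2).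
   The left-hand side is nonnegative and vanishes exactly when g = f a.e.
   This is carried out for Borel functions on a power of a probability space
   and then transferred to the complete Lebesgue measure: g agrees off a Borel
   null set with a Borel function, and almost every slice of a null set is
   null. *)

(** * Completion of a measure *)

Section completion.
Context d (T : measurableType d) (R : realType).
Variable m : {measure set T -> \bar R}.
Local Notation C := (caratheodory_type m^*%mu).
Local Notation cm := (@completed_measure_extension _ _ _ m).

Lemma measurable_completion (A : set T) :
  measurable A -> measurable (A : set C).
Proof. by move=> mA; apply: sub_caratheodory; exact: sub_sigma_algebra. Qed.

Lemma completionE (A : set T) : measurable A -> cm A = m A.
Proof. exact: measurable_mu_extE. Qed.

(* The witness is the intersection over k of covers of X of measure at most
   m^* X + 1/(k+1). *)
Lemma mu_ext_hull (X : set T) :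
  exists F, [/\ measurable F, X `<=` F & m F = m^*%mu X].
Proof.
have [Xoo|Xfin] := eqVneq (m^*%mu X) +oo%E.
  exists setT; split => //; apply/eqP; rewrite eq_le Xoo leey /= -Xoo.
  by rewrite -(measurable_mu_extE m)//; exact: le_mu_ext.
have Xnum : m^*%mu X \is a fin_num.
  by rewrite ge0_fin_numE ?lt_neqAle ?Xfin ?leey//; exact: mu_ext_ge0.
have cover k : exists F, [/\ measurable F, X `<=` F &
    (m F <= m^*%mu X + k.+1%:R^-1%:E)%E].
  have k0 : 0 < k.+1%:R^-1 :> R by rewrite invr_gt0.
  have [_ [B [mB XB] <-] Blt] := lb_ereal_inf_adherent k0 Xnum.
  exists (\bigcup_j B j); split => //; first exact: bigcupT_measurable.
  apply: le_trans (ltW Blt); apply: measure_sigma_subadditive => //.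
  exact: bigcupT_measurable.
have [F FP] := choice cover.
have mF : measurable (\bigcap_k F k).
  by apply: bigcapT_measurable => k; have [] := FP k.
exists (\bigcap_k F k); split => //.
  by move=> x Xx k _; have [_ + _] := FP k; exact.
apply/eqP; rewrite eq_le; apply/andP; split; last first.
  rewrite -(measurable_mu_extE m)//; apply: le_mu_ext.
  by move=> x Xx k _; have [_ + _] := FP k; exact.
apply/lee_addgt0Pr => _/posnumP[e]; near \oo => k.
have [mFk _ Fk] := FP k.
apply: (@le_trans _ _ (m (F k))).
  by apply: le_measure; rewrite ?inE//; exact: bigcap_inf.
apply: (le_trans Fk); rewrite leeD2l// lee_fin ltW//.
by near: k; exact: near_infty_natSinv_lt.
Unshelve. all: by end_near. Qed.

(** A null set of the completion is contained in its hull from [mu_ext_hull], which is measurable in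
    the original algebra and still null. *)
Lemma completion_negligibleP (X : set T) :
  cm.-negligible X <-> m.-negligible X.
Proof.
split=> [[A [mA A0 XA]]|[A [mA A0 XA]]].
  have [F [mF AF FA]] := mu_ext_hull A.
  by exists F; split => //; [rewrite FA | exact: subset_trans AF].
exists A; split => //; first exact: measurable_completion.
by rewrite completionE.
Qed.

(** The hull [F] of [E] has the same measure as [E]; since this measure is finite it can be
    subtracted, so [F] minus [E] is null. *)
Lemma completion_measurable_approx (E : set C) : measurable E ->
  (cm E < +oo)%E ->
  exists F, [/\ measurable (F : set T), E `<=` F & m.-negligible (F `\` E)].
Proof.
move=> mE Eoo; have [F [mF EF FE]] := mu_ext_hull E.
exists F; split => //; apply/completion_negligibleP.
have mFC := measurable_completion mF.
exists (F `\` E); split => //; first exact: measurableD.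
have cFE : cm F = cm E by exact: etrans (completionE mF) FE.
have Foo : (cm F < +oo)%E by rewrite cFE.
apply: (etrans (measureD (mu := cm) mFC mE Foo)).
rewrite (setIidr EF); apply: (etrans (congr1 (fun z => z - cm E)%E cFE)).
by rewrite subee// ge0_fin_numE.
Qed.

(* N collects, over the rationals q, the errors made in approximating each
   {x in D | g x > q} from outside by a set measurable in T. *)
Lemma completion_measurable_fun (D : set C) (g : C -> R) :
  d.-measurable D -> (m D < +oo)%E -> measurable_fun D g ->
  exists N, [/\ measurable N, m N = 0%E &
    measurable_fun [set: T] ((g : T -> R) \_ ((D : set T) `\` N))].
Proof.
move=> mD Doo mg.
have mDC := measurable_completion mD.
pose A (q : rat) : set C := D `&` g @^-1` `]ratr q, +oo[.
have mA q : measurable (A q : set C) 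
  by have := mg mDC _ (measurable_itv (Interval (BRight (ratr q)) +oo%O)).
have AD q : A q `<=` D by move=> x [].
have /choice[F FP] : forall q, exists F,
    [/\ measurable (F : set T), A q `<=` F & m.-negligible (F `\` A q)].
  move=> q; apply: completion_measurable_approx => //.
  apply: le_lt_trans Doo; rewrite -completionE//.
  by apply: le_measure; rewrite ?inE.
have [N [mN N0 FN]] : m.-negligible (\bigcup_q (F q `\` A q)).
  (* The union over the rationals is reindexed by the naturals through [unpickle], to fit countable
     subadditivity. *)
  apply: (@negligibleS _ _ _ _
      (\bigcup_k (if unpickle k is Some q then F q `\` A q else set0))).
    by move=> x [q _ Fx]; exists (pickle q); [exact: I|rewrite pickleK].
  apply: negligible_bigcup => k; case: unpickle => [q|]; last first.
    exact: negligible_set0.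
  by have [] := FP q.
have mDN : d.-measurable ((D : set T) `\` N) by exact: (@measurableD _ T D N).
exists N; split => //; apply: (measurable_restrictT (g : T -> R) mDN).1.
move=> _; apply: (measurability _ (RGenOInfty.measurableE R)) => //.
move=> _ [_ [r ->] <-].
(* On [D] outside [N], [g x > r] holds iff [x] lies in [F q] for some rational [q > r]: one
   direction picks [q] between [r] and [g x], the other holds because [N] absorbs [F q] minus
   [A q]. *)
rewrite (_ : _ `&` _ =
    \bigcup_k (if unpickle k is Some q then
      if r < ratr q then F q `&` (D `\` N) else set0 else set0)); last first.
  apply/seteqP; split=> x /=.
    rewrite in_itv/= andbT => -[[Dx Nx] rg].
    have [q /[!in_itv]/= /andP[rq qg]] := rat_in_itvoo rg.
    exists (pickle q); [exact: I|rewrite pickleK rq; split => //].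
    have [_ + _] := FP q; apply.
    by split => //=; rewrite in_itv/= qg.
  move=> [k _]; case: unpickle => [q|//]; case: ifPn => // rq [Fx [Dx Nx]].
  split => //; apply: contrapT => gr.
  apply: Nx; apply: FN; exists q => //; split => //= -[_] /=.
  rewrite in_itv/= andbT => qg; apply: gr; rewrite in_itv/= andbT.
  exact: lt_trans qg.
apply: bigcupT_measurable => k; case: unpickle => [q|//].
case: ifPn => // _; apply: measurableI; last exact: mDN.
by have [] := FP q.
Qed.
End completion.

(** * Products along one coordinate *)

Section insert.
Context d (T : measurableType d) (n : nat).

(** Same formula as [insert_coord], hence convertible to it, but on pairs, so that it can be
    composed with product measures. *)
Definition insert (i : 'I_n.+1) (p : T * n.-tuple T) : n.+1.-tuple T :=
  [tuple (if unlift i j is Some k then tnth p.2 k else p.1) | j < n.+1].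

Lemma tnth_insert i p : tnth (insert i p) i = p.1.
Proof. by rewrite tnth_mktuple unlift_none. Qed.

Lemma tnth_insert_lift i p k : tnth (insert i p) (lift i k) = tnth p.2 k.
Proof. by rewrite tnth_mktuple liftK. Qed.

Lemma measurable_insert i : measurable_fun [set: _] (insert i).
Proof.
apply/measurable_fun_tnthP => j; case: (unliftP i j) => [k|] ->.
  rewrite (_ : _ \o _ = (@tnth _ _ ^~ k) \o snd).
    by apply: measurableT_comp => //; exact: measurable_tnth.
  by apply/funext => p /=; rewrite tnth_insert_lift.
rewrite (_ : _ \o _ = fst) //.
by apply/funext => p /=; rewrite tnth_insert.
Qed.

Lemma insert0 : insert ord0 = @tuple_cons _ T n.
Proof.
apply/funext => p; apply: eq_from_tnth => j.
case: (unliftP ord0 j) => [k|] ->; last by rewrite tnth_insert.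
by rewrite tnth_insert_lift tnthS.
Qed.

End insert.

(* Lets an induction on the dimension exchange the insertions of x and z. *)
Lemma insert_lift d (T : measurableType d) n (j : 'I_n.+1) (x z : T) w :
  insert (lift ord0 j) (z, insert ord0 (x, w)) =
  insert ord0 (x, insert j (z, w)) :> n.+2.-tuple T.
Proof.
apply: eq_from_tnth => k.
case: (unliftP ord0 k) => [k'|] ->; last first.
  rewrite (_ : ord0 = lift (lift ord0 j) ord0); last exact/val_inj.
  by rewrite tnth_insert_lift -[in RHS](_ : ord0 = lift (lift ord0 j) ord0)
    ?tnth_insert//; exact/val_inj.
rewrite [RHS]tnth_insert_lift /=.
case: (unliftP j k') => [l|] ->; last by rewrite !tnth_insert.
rewrite (_ : lift ord0 (lift j l) = lift (lift ord0 j) (lift ord0 l)).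
  by rewrite !tnth_insert_lift.
by apply/val_inj; rewrite /= /bump !leq0n !add1n ltnS addnS.
Qed.

(** * Fubini along an arbitrary coordinate of a power of a probability space *)

Section iterated_product.
Local Open Scope ereal_scope.
Context d (T : measurableType d) (R : realType).
Variables (mu : probability T R) (P : forall n, probability (n.-tuple T) R).
Hypothesis PS : forall n (A : set (n.+1.-tuple T)), measurable A ->
  P n.+1 A = (mu \x P n) (insert ord0 @^-1` A).

Let ge0_integral_insert0 n (f : n.+1.-tuple T -> \bar R) :
  measurable_fun [set: _] f -> (forall x, 0 <= f x) ->
  \int[P n.+1]_x f x = \int[mu]_x \int[P n]_y f (insert ord0 (x, y)).
Proof.
move=> mf f0.
have mfi : measurable_fun [set: T * n.-tuple T] (f \o insert ord0).
  by apply: measurableT_comp => //; exact: measurable_insert.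
rewrite -(fubini_tonelli1 _ mfi (fun p => f0 _)).
transitivity (\int[pushforward (mu \x P n) (insert ord0)]_x f x).
  by apply: eq_measure_integral => [|mi A mA _];
    [exact: measurable_insert|exact: PS].
by apply: ge0_integral_pushforward => //; exact: measurable_insert.
Qed.

(** Hypothesis [PS] only splits off the first coordinate. For a later one, the first coordinate is
    split off, the induction hypothesis is applied to the slice, Tonelli exchanges the two outer
    integrals, and [insert_lift] lets the first coordinate be put back. *)
Lemma ge0_integral_insert n (i : 'I_n.+1) (f : n.+1.-tuple T -> \bar R) :
  measurable_fun [set: _] f -> (forall x, 0 <= f x) ->
  \int[P n.+1]_x f x = \int[mu]_x \int[P n]_y f (insert i (x, y)).
Proof.
elim: n i f => [|n IH] i f mf f0.
  by rewrite ord1; exact: ge0_integral_insert0.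
case: (unliftP ord0 i) => [j|] ->; last exact: ge0_integral_insert0.
rewrite (ge0_integral_insert0 mf f0).
have mf2 (p : T * T -> T * T) : measurable_fun [set: _] p ->
    measurable_fun [set: (T * T) * n.-tuple T] (fun q =>
      f (insert ord0 ((p q.1).1, insert j ((p q.1).2, q.2)))).
  move=> mp; apply: measurableT_comp => //.
  apply: measurableT_comp; first exact: measurable_insert.
  apply: measurable_fun_pair.
    by do 2 apply: measurableT_comp => //.
  apply: measurableT_comp; first exact: measurable_insert.
  apply: measurable_fun_pair => //.
  by do 2 apply: measurableT_comp => //.
transitivity (\int[mu]_x \int[mu]_z \int[P n]_w
    f (insert ord0 (x, insert j (z, w)))).
  apply: eq_integral => x _; apply: (IH j (fun y => f (insert ord0 (x, y)))).
    apply: measurableT_comp => //.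
    apply: measurableT_comp; first exact: measurable_insert.
    exact: measurable_fun_pair.
  by move=> y.
rewrite (fubini_tonelli (fun p : T * T => \int[P n]_w
  f (insert ord0 (p.1, insert j (p.2, w)))))//; last first.
- by move=> p; exact: integral_ge0.
- apply: (measurable_fun_fubini_tonelli_F (m2 := P n)
    (fun q : (T * T) * n.-tuple T =>
      f (insert ord0 (q.1.1, insert j (q.1.2, q.2))))) => //.
  exact: (mf2 id).
apply: eq_integral => z _.
have mfz : measurable_fun [set: n.+1.-tuple T]
    (fun y => f (insert (lift ord0 j) (z, y))).
  apply: measurableT_comp => //.
  apply: measurableT_comp; first exact: measurable_insert.
  exact: measurable_fun_pair.
rewrite (ge0_integral_insert0 mfz (fun y => f0 _)).
by apply: eq_integral => x _; apply: eq_integral => w _; rewrite insert_lift.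
Qed.

(** Extends [PS] to every coordinate by taking indicators in the Tonelli formula; this yields the
    change of variables for signed functions. *)
Lemma insert_measure n (i : 'I_n.+1) (A : set (n.+1.-tuple T)) :
  measurable A -> (mu \x P n) (insert i @^-1` A) = P n.+1 A.
Proof.
move=> mA.
have mAi : measurable (insert i @^-1` A).
  by rewrite -[X in measurable X]setTI; exact: measurable_insert.
have mind : measurable_fun [set: _] (EFin \o \1_A : _ -> \bar R).
  exact/measurable_EFinP.
have mindi : measurable_fun [set: T * n.-tuple T]
    (EFin \o \1_(insert i @^-1` A) : _ -> \bar R).
  exact/measurable_EFinP.
transitivity (\int[mu \x P n]_p (\1_(insert i @^-1` A) p)%:E).
  by rewrite integral_indic// setIT.
transitivity (\int[P n.+1]_x (\1_A x)%:E); last first.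
  by rewrite integral_indic// setIT.
rewrite (fubini_tonelli1 _ mindi)//; last by move=> x; rewrite lee_fin.
rewrite (ge0_integral_insert i mind)//.
by move=> x; rewrite lee_fin.
Qed.

Lemma integrable_insert n (i : 'I_n.+1) (f : n.+1.-tuple T -> \bar R) :
  (P n.+1).-integrable [set: _] f ->
  (mu \x P n).-integrable [set: _] (f \o insert i).
Proof.
move=> /integrableP[mf foo]; apply/integrableP; split.
  by apply: measurableT_comp => //; exact: measurable_insert.
have mfi : measurable_fun [set: T * n.-tuple T] (abse \o f \o insert i).
  apply: measurableT_comp; last exact: measurable_insert.
  exact: measurableT_comp.
have maf : measurable_fun [set: n.+1.-tuple T] (abse \o f).
  exact: measurableT_comp.
have := ge0_integral_insert i maf (fun x => abse_ge0 _).
rewrite -[RHS](fubini_tonelli1 _ mfi (fun p => abse_ge0 _)).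
by move=> E; move: foo; rewrite E.
Qed.

Lemma integral_insert n (i : 'I_n.+1) (f : n.+1.-tuple T -> \bar R) :
  (P n.+1).-integrable [set: _] f ->
  \int[P n.+1]_x f x = \int[mu]_x \int[P n]_y f (insert i (x, y)).
Proof.
move=> fi; have := integrable_insert i fi => /[dup] fii.
move=> /integral12_prod_meas1 ->.
transitivity (\int[pushforward (mu \x P n) (insert i)]_x f x).
  apply: eq_measure_integral => [|mi A mA _]; first exact: measurable_insert.
  by rewrite /= /pushforward insert_measure.
apply: integral_pushforward => //; first exact: measurable_insert.
exact: measurable_int fi.
Qed.

Lemma ae_integrable_insert n (i : 'I_n.+1) (f : n.+1.-tuple T -> \bar R) :
  (P n.+1).-integrable [set: _] f ->
  {ae mu, forall x, (P n).-integrable [set: _] (fun y => f (insert i (x, y)))}.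
Proof. by move=> /(integrable_insert i) /ae_integrable1. Qed.

Lemma ge0_integral_tnth n (i : 'I_n) (f : T -> \bar R) :
  measurable_fun [set: T] f -> (forall x, 0 <= f x) ->
  \int[P n]_x f (tnth x i) = \int[mu]_x f x.
Proof.
case: n i => [[]//|n] i mf f0.
rewrite (@ge0_integral_insert _ i (fun x => f (tnth x i)))//; last first.
  by apply: measurableT_comp => //; exact: measurable_tnth.
apply: eq_integral => x _; rewrite (eq_integral (cst (f x))).
  by rewrite integral_cst//= probability_setT mule1.
by move=> y _; rewrite tnth_insert.
Qed.

Lemma integral_tnth n (i : 'I_n) (f : T -> \bar R) :
  measurable_fun [set: T] f ->
  \int[P n]_x f (tnth x i) = \int[mu]_x f x.
Proof.
move=> mf; rewrite integralE [RHS]integralE; congr (_ - _).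
- rewrite -(ge0_integral_tnth i (measurable_funepos mf) (funepos_ge0 f)).
  by rewrite (funepos_comp f (@tnth n T ^~ i)).
- rewrite -(ge0_integral_tnth i (measurable_funeneg mf) (funeneg_ge0 f)).
  by rewrite (funeneg_comp f (@tnth n T ^~ i)).
Qed.

Lemma tnth_measure n (i : 'I_n) (A : set T) : measurable A ->
  P n [set x | A (tnth x i)] = mu A.
Proof.
move=> mA; have mAi : measurable [set x : n.-tuple T | A (tnth x i)].
  by rewrite -[X in measurable X]setTI; exact: (measurable_tnth i).
transitivity (\int[P n]_x (\1_[set x | A (tnth x i)] x)%:E).
  by rewrite integral_indic// setIT.
transitivity (\int[mu]_x (\1_A x)%:E); last by rewrite integral_indic// setIT.
have mind : measurable_fun [set: T] (EFin \o \1_A : _ -> \bar R).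
  exact/measurable_EFinP.
by rewrite -(ge0_integral_tnth i mind)// => x; rewrite lee_fin.
Qed.

Lemma ae_tnth n (i : 'I_n) (Q : T -> Prop) : {ae mu, forall t, Q t} ->
  {ae P n, forall x, Q (tnth x i)}.
Proof.
move=> [A [mA A0 QA]]; exists [set x | A (tnth x i)]; split.
- by rewrite -[X in measurable X]setTI; exact: (measurable_tnth i).
- by rewrite /= tnth_measure.
- by move=> x; exact: QA.
Qed.

(** Almost every slice of a null set is null: the measures of the slices integrate to the measure of
    the set, which is 0, and they are nonnegative. *)
Lemma ae_insert n (i : 'I_n.+1) (Q : n.+1.-tuple T -> Prop) :
  {ae P n.+1, forall x, Q x} ->
  {ae mu, forall t, {ae P n, forall y, Q (insert i (t, y))}}.
Proof.
move=> [A [mA A0 QA]].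
have mi t : measurable [set y | A (insert i (t, y))].
  rewrite -[X in measurable X]setTI.
  have : measurable_fun [set: n.-tuple T] (fun y => insert i (t, y)).
    apply: measurableT_comp; first exact: measurable_insert.
    exact: measurable_fun_pair.
  by apply.
have mind : measurable_fun [set: _] (EFin \o \1_A : _ -> \bar R).
  exact/measurable_EFinP.
have int0 : \int[P n.+1]_x (EFin \o \1_A) x = 0.
  by rewrite integral_indic// setIT; exact: A0.
have indi : (P n.+1).-integrable [set: _] (EFin \o \1_A).
  apply/integrableP; split => //.
  rewrite [ltLHS](_ : _ = 0)//; rewrite -[RHS]int0.
  by apply: eq_integral => x _; rewrite /= ger0_norm.
have := integral_insert i indi; rewrite int0.
(* The inner integrals are nonnegative; the absolute value puts the identity in the form required by
   the vanishing criterion [ae_eq_integral_abs]. *)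
have -> : \int[mu]_x \int[P n]_y (EFin \o \1_A) (insert i (x, y)) =
    \int[mu]_x `|\int[P n]_y (EFin \o \1_A) (insert i (x, y))|.
  apply: eq_integral => x _; rewrite gee0_abs// integral_ge0// => y _.
  by rewrite lee_fin.
move=> /esym /(ae_eq_integral_abs _ measurableT
  (measurable_fubini_F (integrable_insert i indi))).1.
apply: filterS => t /(_ I) /= At; exists [set y | A (insert i (t, y))].
split=> //; last by move=> y; exact: QA.
rewrite -[RHS]At.
transitivity (\int[P n]_y (\1_[set y | A (insert i (t, y))] y)%:E) => //.
by rewrite integral_indic// setIT.
Qed.

End iterated_product.

(** * The L^2 identity *)

Section square_integrable.
Context d (T : measurableType d) (R : realType).
Variable mu : probability T R.
Implicit Types f g h : T -> R.

Definition square_integrable f :=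
  measurable_fun [set: T] f /\ (\int[mu]_x ((f x) ^+ 2)%:E < +oo)%E.

Lemma square_integrable_integrable_sqr f : square_integrable f ->
  mu.-integrable [set: T] (EFin \o (fun x => f x ^+ 2)).
Proof.
move=> [mf foo]; apply/integrableP; split.
  exact/measurable_EFinP/measurable_funX.
under eq_integral do rewrite /= ger0_norm ?sqr_ge0//.
exact: foo.
Qed.

(** Domination by [|f g| <= f^2 + g^2]. *)
Lemma square_integrable_mul f g : square_integrable f -> square_integrable g ->
  mu.-integrable [set: T] (EFin \o (fun x => f x * g x)).
Proof.
move=> f2 g2.
apply: (@le_integrable _ _ _ mu _ _ _
    (EFin \o (fun x => f x ^+ 2 + g x ^+ 2))) => //.
- apply/measurable_EFinP/measurable_funM; [exact: f2.1|exact: g2.1].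
- move=> x _; rewrite /= lee_fin [leRHS]ger0_norm ?addr_ge0 ?sqr_ge0//.
  by rewrite ler_norml; apply/andP; split; nra.
- exact: (integrableD measurableT (square_integrable_integrable_sqr f2)
    (square_integrable_integrable_sqr g2)).
Qed.

Lemma square_integrable_cst r : square_integrable (cst r).
Proof.
split; first exact: measurable_cst.
by rewrite /= integral_cst//= probability_setT mule1 ltry.
Qed.

(** The square of the sum is expanded into four products, each integrable by
    [square_integrable_mul]. *)
Lemma square_integrableD f g : square_integrable f -> square_integrable g ->
  square_integrable (fun x => f x + g x).
Proof.
move=> f2 g2; split; first exact: (measurable_funD f2.1 g2.1).
have ffg := integrableD measurableT (square_integrable_mul f2 f2)
  (square_integrable_mul f2 g2).
have ggf := integrableD measurableT (square_integrable_mul f2 g2)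
  (square_integrable_mul g2 g2).
have /integrable_lty := integrableD measurableT ffg ggf.
move=> /(_ measurableT); apply: le_lt_trans; rewrite le_eqVlt; apply/orP; left.
by apply/eqP; apply: eq_integral => x _ /=; rewrite -!EFinD; congr EFin; ring.
Qed.

Lemma square_integrableZ r f : square_integrable f ->
  square_integrable (fun x => r * f x).
Proof.
move=> f2; split; first exact: measurable_funM (measurable_cst _) f2.1.
under eq_integral do rewrite exprMn EFinM.
rewrite ge0_integralZl//.
- by rewrite lte_mul_pinfty ?lee_fin ?sqr_ge0//; exact: f2.2.
- exact/measurable_EFinP/measurable_funX/f2.1.
- by move=> x _; rewrite lee_fin sqr_ge0.
- by rewrite lee_fin sqr_ge0.
Qed.

Lemma square_integrableB f g : square_integrable f -> square_integrable g ->
  square_integrable (fun x => f x - g x).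
Proof.
move=> f2 /(square_integrableZ (-1)) g2.
rewrite (_ : (fun _ => _) = fun x => f x + -1 * g x).
  exact: square_integrableD.
by apply/funext => x; rewrite mulN1r.
Qed.

Lemma square_integrable_sum (I : Type) (s : seq I) (F : I -> T -> R) :
  (forall i, square_integrable (F i)) ->
  square_integrable (fun x => \sum_(i <- s) F i x).
Proof.
move=> F2; elim: s => [|i s IH].
  rewrite (_ : (fun _ => _) = cst 0); first exact: square_integrable_cst.
  by apply/funext => x; rewrite big_nil.
rewrite (_ : (fun _ => _) = fun x => F i x + \sum_(j <- s) F j x).
  exact: square_integrableD.
by apply/funext => x; rewrite big_cons.
Qed.

Lemma square_integrable_integrable f : square_integrable f ->
  mu.-integrable [set: T] (EFin \o f).
Proof.
move=> f2; have := square_integrable_mul f2 (square_integrable_cst 1).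
by congr (_.-integrable _ _); apply/funext => x; rewrite /= mulr1.
Qed.

(** Bridge from the extended-real energies of the theorem to real integrals, where the algebra of
    inner products is done. *)
Lemma square_integrable_sqrE f : square_integrable f ->
  (\int[mu]_x ((f x) ^+ 2)%:E = (\int[mu]_x (f x * f x))%:E)%E.
Proof.
move=> f2; rewrite fineK; last first.
  exact: (integrable_fin_num measurableT (square_integrable_mul f2 f2)).
by apply: eq_integral => x _; rewrite expr2.
Qed.

Lemma Rintegral_mulDl f g h :
  square_integrable f -> square_integrable g -> square_integrable h ->
  \int[mu]_x ((f x + g x) * h x) =
  \int[mu]_x (f x * h x) + \int[mu]_x (g x * h x).
Proof.
move=> f2 g2 h2; under eq_Rintegral do rewrite mulrDl.
by rewrite RintegralD//; exact: square_integrable_mul.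
Qed.

Lemma Rintegral_mulBl f g h :
  square_integrable f -> square_integrable g -> square_integrable h ->
  \int[mu]_x ((f x - g x) * h x) =
  \int[mu]_x (f x * h x) - \int[mu]_x (g x * h x).
Proof.
move=> f2 g2 h2; under eq_Rintegral do rewrite mulrBl.
by rewrite RintegralB//; exact: square_integrable_mul.
Qed.

Lemma Rintegral_mul_suml (I : Type) (s : seq I) (F : I -> T -> R) h :
  (forall i, square_integrable (F i)) -> square_integrable h ->
  \int[mu]_x ((\sum_(i <- s) F i x) * h x) =
  \sum_(i <- s) \int[mu]_x (F i x * h x).
Proof.
move=> F2 h2; elim: s => [|i s IH].
  rewrite big_nil; under eq_Rintegral do rewrite big_nil mul0r.
  by rewrite Rintegral_cst// mul0r.
rewrite big_cons -IH -Rintegral_mulDl//; last exact: square_integrable_sum.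
by under eq_Rintegral do rewrite big_cons.
Qed.

Lemma Rintegral_mul_cstl r h : square_integrable h ->
  \int[mu]_x (r * h x) = r * \int[mu]_x h x.
Proof.
by move=> h2; rewrite RintegralZl//; exact: square_integrable_integrable.
Qed.

Lemma Rintegral_cst_probability r : \int[mu]_(_ in [set: T]) r = r.
Proof. by rewrite Rintegral_cst//= probability_setT mulr1. Qed.

(* Without square integrability the right-hand side is +oo. *)
Lemma sqr_Rintegral_le f : measurable_fun [set: T] f ->
  (((\int[mu]_x f x) ^+ 2)%:E <= \int[mu]_x ((f x) ^+ 2)%:E)%E.
Proof.
move=> mf; have [f2oo|] := ltP (\int[mu]_x ((f x) ^+ 2)%:E)%E +oo%E; last first.
  by rewrite leye_eq => /eqP ->; rewrite leey.
have f2 : square_integrable f by [].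
set c := \int[mu]_x f x.
have c2 : square_integrable (cst c) by exact: square_integrable_cst.
have fc2 := square_integrableB f2 c2.
(* Nonnegativity of the variance. As [c] is the mean, [f - c] has integral 0, and the expansion
   leaves the integral of [f^2] minus [c^2]. *)
have : 0 <= \int[mu]_x ((f x - c) * (f x - c)).
  by apply: Rintegral_ge0 => x _; rewrite -expr2 sqr_ge0.
rewrite (Rintegral_mulBl f2 c2 fc2).
rewrite (Rintegral_mul_cstl c fc2) RintegralB//; last 2 first.
- exact: square_integrable_integrable.
- exact: square_integrable_integrable.
rewrite Rintegral_cst_probability -/c subrr mulr0 subr0.
under eq_Rintegral do rewrite mulrC.
rewrite (Rintegral_mulBl f2 c2 f2) (Rintegral_mul_cstl c f2) -/c subr_ge0.
by rewrite square_integrable_sqrE// lee_fin expr2.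
Qed.

Lemma Rintegral_mulff_eq0 f : square_integrable f ->
  \int[mu]_x (f x * f x) = 0 <-> {ae mu, forall x, f x = 0}.
Proof.
move=> f2; have mff : measurable_fun [set: T] (EFin \o (fun x => f x * f x)).
  exact: measurable_int (square_integrable_mul f2 f2).
have absE : (\int[mu]_x `|(f x * f x)%:E| = (\int[mu]_x (f x * f x)%R)%R%:E)%E.
  rewrite -square_integrable_sqrE//; apply: eq_integral => x _.
  by rewrite /= -expr2 ger0_norm ?sqr_ge0.
have -> : \int[mu]_x (f x * f x) = 0 <-> (\int[mu]_x `|(f x * f x)%:E| = 0)%E.
  by rewrite absE; split=> [->|[]].
rewrite (ae_eq_integral_abs _ measurableT mff).
split; apply: filterS => x; last by move=> /= -> _; rewrite mulr0.
by move=> /(_ I) /= [] /eqP; rewrite mulf_eq0 orbb => /eqP.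
Qed.

End square_integrable.

(** * Conditional means and the first-order Hoeffding projection *)

Section hoeffding.
Context d (T : measurableType d) (R : realType).
Variables (mu : probability T R) (P : forall n, probability (n.-tuple T) R).
Hypothesis PS : forall n (A : set (n.+1.-tuple T)), measurable A ->
  P n.+1 A = (mu \x P n)%E (insert ord0 @^-1` A).
Variable n : nat.
Implicit Types (g : n.+1.-tuple T -> R) (i j : 'I_n.+1).

(** The conditional expectation of [g] given the [i]-th coordinate; with [cube_prob] it is the Borel
    counterpart of [marginal]. *)
Definition cond_mean g i (x : T) : R := \int[P n]_y g (insert i (x, y)).

Lemma measurable_cond_mean g i : square_integrable (P n.+1) g ->
  measurable_fun [set: T] (cond_mean g i).
Proof.
move=> /square_integrable_integrable /(integrable_insert PS i).
move=> /measurable_fubini_F mF.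
exact: (measurableT_comp _ mF).
Qed.

(** Jensen's inequality for the square on each slice, then Tonelli. *)
Lemma square_integrable_cond_mean g i : square_integrable (P n.+1) g ->
  square_integrable mu (cond_mean g i).
Proof.
move=> g2; split; first exact: measurable_cond_mean.
have mg2 : measurable_fun [set: n.+1.-tuple T] (fun x => ((g x) ^+ 2)%:E).
  by apply/measurable_EFinP; exact: (measurable_funX 2 g2.1).
have mgi : measurable_fun [set: T * n.-tuple T] (g \o insert i).
  by apply: measurableT_comp; [exact: g2.1|exact: measurable_insert].
apply: le_lt_trans g2.2.
rewrite (ge0_integral_insert PS i mg2); last first.
  by move=> x; rewrite lee_fin sqr_ge0.
apply: ge0_le_integral => //.
- by move=> x _; rewrite lee_fin sqr_ge0.
- exact/measurable_EFinP/measurable_funX/measurable_cond_mean.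
- apply: (measurable_fun_fubini_tonelli_F (m2 := P n)
    (fun p => ((g (insert i p)) ^+ 2)%:E)).
    by apply/measurable_EFinP; exact: (measurable_funX 2 mgi).
  by move=> p; rewrite lee_fin sqr_ge0.
(* This covers every slice, including those on which [g^2] has infinite integral. *)
- move=> x _; apply: sqr_Rintegral_le.
  by apply: (measurableT_comp mgi); exact: measurable_fun_pair.
Qed.

Lemma square_integrable_tnth (u : T -> R) i : square_integrable mu u ->
  square_integrable (P n.+1) (fun x => u (tnth x i)).
Proof.
move=> u2; split.
  by apply: measurableT_comp; [exact: u2.1|exact: measurable_tnth].
rewrite (ge0_integral_tnth PS i (f := fun x => ((u x) ^+ 2)%:E)).
- exact: u2.2.
- exact/measurable_EFinP/measurable_funX/u2.1.
- by move=> x; rewrite lee_fin sqr_ge0.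
Qed.

(** On a slice with fixed [i]-th coordinate the factor [u] is constant and leaves the inner
    integral. Slices of [g] are integrable only almost everywhere, so the inner integrals are
    compared almost everywhere. *)
Lemma Rintegral_mul_cond_mean (u : T -> R) g i :
  square_integrable mu u -> square_integrable (P n.+1) g ->
  \int[P n.+1]_x (u (tnth x i) * g x) = \int[mu]_x (u x * cond_mean g i x).
Proof.
move=> u2 g2; have ui2 := square_integrable_tnth i u2.
have ug := square_integrable_mul ui2 g2.
congr fine; rewrite (integral_insert PS i ug).
have mL := measurable_fubini_F (integrable_insert PS i ug).
apply: ae_eq_integral => //.
- apply/measurable_EFinP/measurable_funM; first exact: u2.1.
  exact: measurable_cond_mean.
- have := ae_integrable_insert PS i (square_integrable_integrable g2).
  apply: filterS => x gx _.
  transitivity (\int[P n]_y ((u x)%:E * (g (insert i (x, y)))%:E))%E.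
    by apply: eq_integral => y _; rewrite /= tnth_insert EFinM.
  rewrite integralZl// EFinM; congr (_ * _)%E.
  by rewrite fineK//; exact: (integrable_fin_num measurableT gx).
Qed.

Lemma Rintegral_tnth n' (i : 'I_n') (u : T -> R) : measurable_fun [set: T] u ->
  \int[P n']_x u (tnth x i) = \int[mu]_x u x.
Proof.
move=> mu'; congr fine; apply: (integral_tnth PS i (f := EFin \o u)).
exact/measurable_EFinP.
Qed.

(** Independence of distinct coordinates: the conditional mean of [v (tnth x j)] given coordinate
    [i] is the constant integral of [v]. *)
Lemma Rintegral_tnth_mul i j (u v : T -> R) : i != j ->
  square_integrable mu u -> square_integrable mu v ->
  \int[P n.+1]_x (u (tnth x i) * v (tnth x j)) =
  (\int[mu]_x u x) * (\int[mu]_x v x).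
Proof.
move=> ij u2 v2.
rewrite (Rintegral_mul_cond_mean i u2 (square_integrable_tnth j v2)).
case: (unliftP i j) ij => [k|] ->; last by rewrite eqxx.
move=> _; rewrite -RintegralZr//; last exact: square_integrable_integrable.
apply: eq_Rintegral => x _; congr (_ * _).
rewrite -(Rintegral_tnth k v2.1); apply: eq_Rintegral => y _.
by rewrite tnth_insert_lift.
Qed.

(** The function [f] of the proof idea. The dimension is [n.+1], so the coefficient [n] is the
    dimension minus one. *)
Definition additive_part g (x : n.+1.-tuple T) : R :=
  \sum_(i < n.+1) cond_mean g i (tnth x i) - n%:R * \int[P n.+1]_y g y.

Lemma Rintegral_cond_mean g i : square_integrable (P n.+1) g ->
  \int[mu]_x cond_mean g i x = \int[P n.+1]_x g x.
Proof.
move=> g2; have := Rintegral_mul_cond_mean i (square_integrable_cst mu 1) g2.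
under eq_Rintegral do rewrite mul1r.
by under [RHS]eq_Rintegral do rewrite mul1r.
Qed.

Lemma square_integrable_additive_part g : square_integrable (P n.+1) g ->
  square_integrable (P n.+1) (additive_part g).
Proof.
move=> g2; apply: square_integrableB; last exact: square_integrable_cst.
apply: square_integrable_sum => i.
exact/square_integrable_tnth/square_integrable_cond_mean.
Qed.

(** Used with [h] equal to [g], to 1, to the additive part itself and to a single conditional
    mean. *)
Lemma Rintegral_additive_part_mul g h : square_integrable (P n.+1) g ->
  square_integrable (P n.+1) h ->
  \int[P n.+1]_x (additive_part g x * h x) =
  \sum_(i < n.+1) \int[P n.+1]_x (cond_mean g i (tnth x i) * h x) -
  n%:R * (\int[P n.+1]_x g x) * \int[P n.+1]_x h x.
Proof.
move=> g2 h2; have gi2 i :=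
  square_integrable_tnth i (square_integrable_cond_mean i g2).
have s2 := square_integrable_sum (index_enum _) gi2.
have c2 := square_integrable_cst (P n.+1) (n%:R * \int[P n.+1]_y g y).
apply: etrans (Rintegral_mulBl s2 c2 h2) _.
by rewrite Rintegral_mul_suml// Rintegral_mul_cstl.
Qed.

Lemma Rintegral_sqr_sub_additive_part g : square_integrable (P n.+1) g ->
  \int[P n.+1]_x ((g x - additive_part g x) * (g x - additive_part g x)) =
  \int[P n.+1]_x (g x * g x) -
  (\sum_(i < n.+1) \int[mu]_x (cond_mean g i x * cond_mean g i x)
   - n%:R * (\int[P n.+1]_x g x) ^+ 2).
Proof.
move=> g2; set m := \int[P n.+1]_x g x; set S := \sum_(i < n.+1) _.
have h2 i := square_integrable_cond_mean i g2.
have f2 := square_integrable_additive_part g2.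
have fg : \int[P n.+1]_x (additive_part g x * g x) = S - n%:R * m ^+ 2.
  rewrite Rintegral_additive_part_mul// -/m expr2 mulrA; congr (_ - _).
  by apply: eq_bigr => i _; exact: Rintegral_mul_cond_mean.
(* Each of the [n.+1] conditional means has integral [m], and [n * m] is subtracted. *)
have f1 : \int[P n.+1]_x additive_part g x = m.
  have := Rintegral_additive_part_mul g2 (square_integrable_cst (P n.+1) 1).
  under eq_Rintegral do rewrite mulr1.
  rewrite Rintegral_cst_probability mulr1 -/m => ->.
  rewrite (eq_bigr (fun=> m)) => [|i _].
    by rewrite sumr_const card_ord mulrS mulr_natl addrK.
  under eq_Rintegral do rewrite mulr1.
  rewrite Rintegral_tnth; last exact: (h2 i).1.
  exact: Rintegral_cond_mean.
have ff : \int[P n.+1]_x (additive_part g x * additive_part g x) =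
    S - n%:R * m ^+ 2.
  rewrite Rintegral_additive_part_mul// f1 -/m expr2 mulrA; congr (_ - _).
  (* Pairing the additive part with the [i]-th conditional mean: the diagonal term is the wanted
     square, the [n] others each give [m * m] by independence, and they cancel against the constant
     term. *)
  apply: eq_bigr => i _; under eq_Rintegral do rewrite mulrC.
  rewrite Rintegral_additive_part_mul//; last exact: square_integrable_tnth.
  rewrite (bigD1 i)//= (eq_bigr (fun=> m * m)) => [|j ji]; last first.
    by rewrite Rintegral_tnth_mul// !Rintegral_cond_mean.
  rewrite (Rintegral_tnth (n' := n.+1) i (u := fun x =>
    cond_mean g i x * cond_mean g i x)); last first.
    exact: (measurable_funM (h2 i).1 (h2 i).1).
  rewrite Rintegral_tnth ?Rintegral_cond_mean//; last exact: (h2 i).1.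
  by rewrite sumr_const cardC1 card_ord /= -/m -mulrA mulr_natl addrK.
have gf2 := square_integrableB g2 f2.
rewrite (Rintegral_mulBl g2 f2 gf2).
under eq_Rintegral do rewrite mulrC.
under [X in _ - X]eq_Rintegral do rewrite mulrC.
(* With [f] the additive part, the expansion is [(<g,g> - <f,g>) - (<g,f> - <f,f>)], whose second
   bracket vanishes. *)
by rewrite (Rintegral_mulBl g2 f2 g2) (Rintegral_mulBl g2 f2 f2) fg ff
  [X in _ - (X - _)](_ : _ = S - n%:R * m ^+ 2) ?subrr ?subr0// -fg;
  under eq_Rintegral do rewrite mulrC.
Qed.

End hoeffding.

(** * Lebesgue measure on the unit cube *)

(** The complement of [D] is null for the restricted measure, and inside [D] the two measures agree;
    signed functions are split into positive and negative parts. *)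
Lemma integral_mrestr d (T : measurableType d) (R : realType)
    (m : {measure set T -> \bar R}) (D : set T) (mD : measurable D)
    (f : T -> \bar R) : measurable_fun [set: T] f ->
  (\int[mrestr m mD]_x f x = \int[m]_(x in D) f x)%E.
Proof.
have ge0 h : measurable_fun [set: T] h -> (forall x, 0 <= h x)%E ->
    (\int[mrestr m mD]_x h x = \int[m]_(x in D) h x)%E.
  move=> mh h0; transitivity (\int[mrestr m mD]_(x in D) h x)%E.
    rewrite (@ge0_negligible_integral _ _ _ _ _ (~` D))//.
    - by rewrite setDE setCK setTI.
    - exact: measurableC.
    - by rewrite /= /mrestr setICl measure0.
  by apply: eq_measure_integral => A _ AD; rewrite /= /mrestr setIidl.
by move=> mf; rewrite [LHS]integralE [RHS]integralE !ge0//;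
  [exact: measurable_funeneg|exact: measurable_funepos].
Qed.

(** Change of variables along a measure-preserving map. It is applied to the identity from a
    completed sigma-algebra to the Borel one. *)
Lemma integral_preimage d d' (X : measurableType d) (Y : measurableType d')
    (R : realType) (phi : X -> Y) (mX : {measure set X -> \bar R})
    (mY : {measure set Y -> \bar R}) (D : set Y) (f : Y -> \bar R) :
  measurable_fun [set: X] phi ->
  (forall A, measurable A -> mX (phi @^-1` A) = mY A) ->
  measurable D -> measurable_fun D f ->
  (\int[mX]_(x in phi @^-1` D) f (phi x) = \int[mY]_(y in D) f y)%E.
Proof.
move=> mphi XY mD.
have ge0 h : measurable_fun D h -> (forall x, 0 <= h x)%E ->
    (\int[mX]_(x in phi @^-1` D) h (phi x) = \int[mY]_(y in D) h y)%E.
  move=> mh h0; rewrite -[LHS](ge0_integral_pushforward mphi mX mD mh)//.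
  by apply: eq_measure_integral => A mA _; exact: XY.
move=> mf; rewrite [LHS]integralE [RHS]integralE; congr (_ - _)%E.
- rewrite -(ge0 _ (measurable_funepos mf) (funepos_ge0 f)).
  by rewrite (funepos_comp f phi).
- rewrite -(ge0 _ (measurable_funeneg mf) (funeneg_ge0 f)).
  by rewrite (funeneg_comp f phi).
Qed.

Section cube_probability.
Context (R : realType).
Local Notation T := (measurableTypeR R).

(** Restricting the measure instead of the domain gives a probability on the whole line, as the
    abstract sections require; [cube_prob] follows the same pattern. *)
Definition itv01_prob : set T -> \bar R :=
  mrestr lebesgue_measure (measurable_itv `[0%R : R, 1]).

HB.instance Definition _ := Measure.on itv01_prob.

Let itv01_prob_setT : itv01_prob setT = 1%E.
Proof.
rewrite /itv01_prob /mrestr setTI lebesgue_measure_itv/= lte_fin ltr01.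
by rewrite oppr0 adde0.
Qed.

HB.instance Definition _ :=
  Measure_isProbability.Build _ _ _ itv01_prob itv01_prob_setT.

Lemma measurable_unit_cube n : measurable (unit_cube R n : set (n.-tuple T)).
Proof.
rewrite [X in measurable X](_ : _ =
    \bigcap_(i in [set: 'I_n]) (@tnth _ _ ^~ i) @^-1` `[0%R, 1]).
  apply: fin_bigcap_measurable => // i _.
  by rewrite -[X in measurable X]setTI; exact: measurable_tnth.
by apply/seteqP; split=> t /= h i => [_|]; exact: h.
Qed.

Arguments measurable_unit_cube : clear implicits.

Lemma borel_lebesgue_unit_cube n : borel_lebesgue R n (unit_cube R n) = 1%E.
Proof.
rewrite (@borel_lebesgue_box R n (fun=> `[0%R, 1]%classic))//.
rewrite big1// => i _; rewrite lebesgue_measure_itv/= lte_fin ltr01.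
by rewrite oppr0 adde0.
Qed.

Definition cube_prob n : set (n.-tuple T) -> \bar R :=
  mrestr (borel_lebesgue R n) (measurable_unit_cube n).
Arguments cube_prob : clear implicits.

HB.instance Definition _ (n : nat) := Measure.on (cube_prob n).

Let cube_prob_setT n : cube_prob n setT = 1%E.
Proof. by rewrite /cube_prob /mrestr setTI borel_lebesgue_unit_cube. Qed.

HB.instance Definition _ (n : nat) :=
  Measure_isProbability.Build _ _ _ (cube_prob n) (cube_prob_setT n).

(** Discharges [PS]: by uniqueness of the product measure, the product of the two restrictions is
    the restriction of the product to the unit interval times the cube. *)
Lemma cube_probS n (A : set (n.+1.-tuple T)) : measurable A ->
  cube_prob n.+1 A = (itv01_prob \x cube_prob n)%E (insert ord0 @^-1` A).
Proof.
move=> mA; have mD := measurableX (measurable_itv `[0%R : R, 1])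
  (measurable_unit_cube n).
rewrite (@product_measure_unique _ _ _ _ _ _ _
  (mrestr (lebesgue_measure \x borel_lebesgue R n)%E mD)); last 2 first.
- move=> B C mB mC; rewrite /= /mrestr -setXI product_measure1E//.
  + exact: measurableI.
  + by apply: measurableI => //; exact: measurable_unit_cube.
- by rewrite -[X in measurable X]setTI; exact: measurable_insert.
rewrite /cube_prob /mrestr /= /cons_measure /pushforward insert0.
congr (_ _); apply/seteqP; split=> -[x y] [/= Axy].
  move=> h; split => //; split; first by have := h ord0.
  by move=> i; have := h (lift ord0 i); rewrite tnthS.
move=> [hx hy]; split => // i; case: (unliftP ord0 i) => [j|] -> //.
by rewrite tnthS; exact: hy.
Qed.

End cube_probability.
Arguments measurable_unit_cube : clear implicits.
Arguments itv01_prob : clear implicits.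
Arguments cube_prob : clear implicits.

(** * Comparison of the complete Lebesgue measures with the Borel probabilities *)

Section completed_cube.
Context (R : realType).
Local Notation T := (measurableTypeR R).

Lemma measurable_id_lebesgue n :
  measurable_fun [set: lebesgue_space R n] (id : _ -> n.-tuple T).
Proof. by move=> _ A mA; rewrite setTI; exact: measurable_completion. Qed.

Lemma integral_lebesgue_cube n (f : n.-tuple T -> \bar R) :
  measurable_fun [set: _] f ->
  (\int[lebesgue R n]_(x in unit_cube R n) f x = \int[cube_prob R n]_x f x)%E.
Proof.
move=> mf; rewrite [RHS]integral_mrestr//.
apply: (integral_preimage (@measurable_id_lebesgue n)) => //.
- by move=> A mA; exact: completionE.
- exact: measurable_unit_cube.
- exact: measurable_funTS.
Qed.

(** Completion creates no new negligible sets, and the complement of the cube is null for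
    [cube_prob]. *)
Lemma ae_lebesgue_cube n (Q : n.-tuple T -> Prop) :
  {ae lebesgue R n, forall x, unit_cube R n x -> Q x} <->
  {ae cube_prob R n, forall x, Q x}.
Proof.
have nP X : (lebesgue R n).-negligible X <-> (borel_lebesgue R n).-negligible X.
  exact: completion_negligibleP.
split=> [/nP[A [mA A0 QA]]|[A [mA A0 QA]]].
  exists (A `|` ~` unit_cube R n); split.
  - apply: measurableU => //; apply: measurableC.
    exact: measurable_unit_cube.
  - rewrite /= /cube_prob /mrestr setIUl setICl setU0.
    apply/eqP; rewrite -measure_le0 -[leRHS]A0.
    apply: le_measure; rewrite ?inE//.
    by apply: measurableI => //; exact: measurable_unit_cube.
  - move=> x /= Qx; have [Cx|] := pselect (unit_cube R n x); last by right.
    by left; apply: QA => /= /(_ Cx).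
apply/nP; exists (A `&` unit_cube R n); split => //.
  by apply: measurableI => //; exact: measurable_unit_cube.
by move=> x /not_implyP[Cx Qx]; split => //; exact: QA.
Qed.

(** The measure on the line in the theorem is the Caratheodory extension of interval length, not an
    instance of [lebesgue]; hence separate one-dimensional versions of the comparisons. *)
Lemma measurable_id_completed_lebesgue :
  measurable_fun [set: _] (id : caratheodory_type (@wlength R idfun)^*%mu -> T).
Proof.
move=> _ A mA; rewrite setTI.
exact: (@sub_caratheodory _ _ _ (@wlength R idfun)).
Qed.

Lemma integral_completed_itv01 (f : T -> \bar R) : measurable_fun [set: _] f ->
  (\int[completed_lebesgue_measure]_(t in `[0%R, 1%R]) f t =
   \int[itv01_prob R]_t f t)%E.
Proof.
move=> mf; rewrite [RHS]integral_mrestr//.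
apply: (integral_preimage (@measurable_id_completed_lebesgue)) => //.
exact: measurable_funTS.
Qed.

Lemma ae_completed_itv01 (Q : T -> Prop) : {ae itv01_prob R, forall t, Q t} ->
  {ae @completed_lebesgue_measure R, forall t, `[0%R, 1%R]%classic t -> Q t}.
Proof.
move=> [A [mA A0 QA]]; exists (A `&` `[0%R, 1]); split => //.
  apply: (@sub_caratheodory _ _ _ (@wlength R idfun)).
  by apply: (@measurableI _ T) => //; exact: measurable_itv.
by move=> x /not_implyP[Cx Qx]; split => //; exact: QA.
Qed.

End completed_cube.

(** * Replacing a Lebesgue-measurable function by a Borel representative *)

Section borel_version.
Context (R : realType) (n : nat).
Local Notation T := (measurableTypeR R).
Local Notation cube := (unit_cube R n.+1).
Variables (g : lebesgue_space R n.+1 -> R) (h : n.+1.-tuple T -> R).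
Hypotheses (mg : measurable_fun cube g) (mh : measurable_fun [set: _] h).
Hypothesis gh : {ae lebesgue R n.+1, forall x, cube x -> g x = h x}.

Let mC : measurable cube.
Proof. by apply: measurable_completion; exact: measurable_unit_cube. Qed.

Lemma measurable_lebesgue_fun k (u : k.-tuple T -> \bar R)
    (D : set (lebesgue_space R k)) :
  measurable_fun [set: _] u -> measurable_fun D u.
Proof.
move=> mu; apply: measurable_funTS.
exact: (measurableT_comp mu (@measurable_id_lebesgue R k)).
Qed.

(** Taking [phi] to be the identity handles the mean, and the square handles the energy. *)
Lemma integral_borel_version (phi : R -> R) : measurable_fun [set: R] phi ->
  (\int[lebesgue R n.+1]_(x in cube) (phi (g x))%:E =
   \int[cube_prob R n.+1]_x (phi (h x))%:E)%E.
Proof.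
move=> mphi.
have mph : measurable_fun [set: n.+1.-tuple T] (fun x => (phi (h x))%:E).
  by apply/measurable_EFinP; exact: measurableT_comp.
apply: (etrans _ (integral_lebesgue_cube mph)).
have mpg : measurable_fun cube (fun x => (phi (g x))%:E).
  by apply/measurable_EFinP; exact: measurableT_comp.
apply: ae_eq_integral;
  [exact: mC|exact: mpg|exact: measurable_lebesgue_fun mph|].
by apply: filterS gh => x E Cx; rewrite E.
Qed.

(** By [ae_insert], on almost every slice [g] and [h] agree almost everywhere. *)
Lemma ae_marginal_borel_version (i : 'I_n.+1) :
  {ae itv01_prob R, forall t, marginal g i t = cond_mean (cube_prob R) h i t}.
Proof.
have /ae_lebesgue_cube gh' := gh.
have := ae_insert (@cube_probS R) i gh'.
apply: filterS => t ght; congr fine.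
have {}ght := (ae_lebesgue_cube (fun y => _ = h (insert i (t, y)))).2 ght.
have mht : measurable_fun [set: n.-tuple T] (fun y => (h (insert i (t, y)))%:E).
  apply/measurable_EFinP; apply: (measurableT_comp mh).
  apply: measurableT_comp; first exact: measurable_insert.
  exact: measurable_fun_pair.
have mhC : measurable_fun (unit_cube R n)
    ((fun y => (h (insert i (t, y)))%:E) : lebesgue_space R n -> \bar R).
  exact: measurable_lebesgue_fun.
apply: (etrans _ (integral_lebesgue_cube mht)).
have mCn : measurable (unit_cube R n).
  by apply: measurable_completion; exact: measurable_unit_cube.
have mgt : measurable_fun (unit_cube R n)
    ((fun y => (g (insert i (t, y)))%:E) : lebesgue_space R n -> \bar R).
  (* A slice of a Lebesgue-measurable function may fail to be measurable; here completeness gives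
     measurability from almost everywhere equality with a Borel slice. *)
  apply: ae_measurable_fun mhC; first exact: measure_is_complete_caratheodory.
  by apply: filterS ght => y E Cy; rewrite -E.
apply: ae_eq_integral; [exact: mCn|exact: mgt|exact: mhC|].
by apply: filterS ght => y E Cy; rewrite -E.
Qed.

Lemma integral_marginal_borel_version (i : 'I_n.+1) :
  square_integrable (cube_prob R n.+1) h ->
  (\int[completed_lebesgue_measure]_(t in `[0%R, 1%R])
     ((marginal g i t) ^+ 2)%:E =
   (\int[itv01_prob R]_t
     (cond_mean (cube_prob R) h i t * cond_mean (cube_prob R) h i t)%R)%R%:E)%E.
Proof.
move=> h2.
have c2 := square_integrable_cond_mean (@cube_probS R) i h2.
have mc : measurable_fun [set: T]
    (fun t => ((cond_mean (cube_prob R) h i t) ^+ 2)%:E).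
  by apply/measurable_EFinP; exact: (measurable_funX 2 c2.1).
rewrite -square_integrable_sqrE//.
apply: (etrans _ (integral_completed_itv01 mc)).
have mcC := measurableT_comp mc (@measurable_id_completed_lebesgue R).
have e : {ae @completed_lebesgue_measure R, forall t, `[0%R, 1%R]%classic t ->
    ((cond_mean (cube_prob R) h i t) ^+ 2)%:E = ((marginal g i t) ^+ 2)%:E}.
  apply: ae_completed_itv01; have := ae_marginal_borel_version i.
  by apply: (@filterS T _ (ae_filter_ringOfSetsType (itv01_prob R))) => t ->.
pose I : set (caratheodory_type (@wlength R idfun)^*%mu) := `[0%R, 1%R]%classic.
have mI : measurable I.
  by have := @measurable_id_completed_lebesgue R measurableT _
    (measurable_itv `[0%R, 1%R]); rewrite setTI.
have mcI := measurable_funTS (D := I) mcC.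
apply: ae_eq_integral; [exact: mI| |exact: mcI|].
  (* The marginal is only known to equal a Borel function almost everywhere, so its measurability
     also comes from completeness. *)
  apply: ae_measurable_fun e mcI.
  exact: completed_lebesgue_measure_is_complete.
apply: ae_completed_itv01; have := ae_marginal_borel_version i.
by apply: (@filterS T _ (ae_filter_ringOfSetsType (itv01_prob R))) => t ->.
Qed.

(** Each exceptional null set on the line lifts to a null cylinder by [ae_tnth], and there are
    finitely many coordinates. *)
Lemma ae_Phi_bar_borel_version :
  {ae cube_prob R n.+1, forall x,
    Phi_bar g x = additive_part (cube_prob R) h x}.
Proof.
have : {ae cube_prob R n.+1, forall x, forall i : 'I_n.+1,
    marginal g i (tnth x i) = cond_mean (cube_prob R) h i (tnth x i)}.
  apply: filter_forall => i.
  exact: (ae_tnth (@cube_probS R) i (ae_marginal_borel_version i)).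
apply: (@filterS _ _ (ae_filter_ringOfSetsType (cube_prob R n.+1))) => x E.
rewrite /Phi_bar /additive_part; congr (_ - _ * _).
  by apply: eq_bigr => i _; exact: E.
have mid : measurable_fun [set: R] (@id R) by exact: measurable_id.
congr fine; exact: (integral_borel_version mid).
Qed.

End borel_version.


Theorem theorem2p7 (R : realType) (n : nat)
    (g : lebesgue_space R n -> measurableTypeR R) :
  (2 <= n)%N ->
  L2_unit_cube g ->
  let mean := \int[lebesgue R n]_(x in unit_cube R n) g x in
  let energy := (\int[lebesgue R n]_(x in unit_cube R n) ((g x) ^+ 2)%:E)%E in
  let bound :=
    (\sum_(i < n)
        \int[completed_lebesgue_measure]_(t in `[0%R, 1%R])
          ((marginal g i t) ^+ 2)%:E
     - (n.-1%:R * mean ^+ 2)%:E)%E in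
  (bound <= energy)%E /\
  (energy = bound <->
   g = Phi_bar g %[ae lebesgue R n in unit_cube R n]).
Proof.
case: n g => [//|n'] g' _ [mg g2] mean energy bound.
have mC := measurable_unit_cube R n'.+1.
have Coo : (borel_lebesgue R n'.+1 (unit_cube R n'.+1) < +oo)%E.
  by rewrite borel_lebesgue_unit_cube ltry.
have [N [mN N0 mh]] := completion_measurable_fun mC Coo mg.
(* [h] is the Borel representative: [g'] on the cube minus the null set [N], and 0 elsewhere. *)
set h := (X in measurable_fun _ X) in mh.
have gh : {ae lebesgue R n'.+1, forall x, unit_cube R n'.+1 x -> g' x = h x}.
  exists N; split; first exact: measurable_completion.
    by rewrite -N0; exact: completionE.
  move=> x /not_implyP[Cx gx]; apply: contrapT => Nx; apply: gx.
  by rewrite /h patchE mem_set.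
have meanE : mean = \int[cube_prob R n'.+1]_x h x.
  have mid : measurable_fun [set: R] (@id R) by exact: measurable_id.
  congr fine; exact: (integral_borel_version mg mh gh mid).
have msqr : measurable_fun [set: R] (fun x : R => x ^+ 2).
  exact: exprn_measurable.
have energyE := integral_borel_version mg mh gh msqr.
have h2 : square_integrable (cube_prob R n'.+1) h.
  by split => //; rewrite -energyE.
have fh2 := square_integrable_additive_part (@cube_probS R) h2.
have hf2 := square_integrableB h2 fh2.
have key := Rintegral_sqr_sub_additive_part (@cube_probS R) h2.
have zero := Rintegral_mulff_eq0 hf2.
have pos : 0 <= \int[cube_prob R n'.+1]_x
   ((h x - additive_part (cube_prob R) h x) *
    (h x - additive_part (cube_prob R) h x)).
  by apply: Rintegral_ge0 => x _; rewrite -expr2 sqr_ge0.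
move: zero pos; rewrite key.
set S := \sum_(i < _) _; set E := Rintegral _ _ _ => zero pos.
(* Both sides of the inequality are finite, so the comparison reduces to real numbers, where [key]
   applies. *)
have -> : bound = (S - n'%:R * mean ^+ 2)%:E.
  rewrite /bound EFinB; congr (_ - _)%E.
  rewrite -sumEFin; apply: eq_bigr => i _.
  exact: integral_marginal_borel_version.
have -> : energy = E%:E by rewrite -square_integrable_sqrE.
rewrite -meanE in zero pos.
split; first by rewrite lee_fin -subr_ge0.
have -> : E%:E = (S - n'%:R * mean ^+ 2)%:E <-> E - (S - n'%:R * mean ^+ 2) = 0.
  by split=> [[->]|/subr0_eq ->//]; rewrite subrr.
rewrite zero.
have Phi := ae_Phi_bar_borel_version mg mh gh.
have gh' := (ae_lebesgue_cube _).1 gh.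
have filterS3 := @filterS3 _ _ (ae_filter_ringOfSetsType (cube_prob R n'.+1)).
(* Vanishing of [h - additive_part h] almost everywhere is carried to [g' = Phi_bar g'] and back
   through [gh'] and [Phi]. *)
split=> [hf|gP].
  apply/(ae_lebesgue_cube (fun x => g' x = Phi_bar g' x)).
  by apply: filterS3 hf Phi gh' => x /subr0_eq hx -> ->.
have {}gP := (ae_lebesgue_cube (fun x => g' x = Phi_bar g' x)).1 gP.
by apply: filterS3 gP Phi gh' => x gx Px hx; rewrite -Px -gx hx subrr.
Qed.
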